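(* Let $J$ be a Jacobi operator such that $J=\Delta+K$ where $K$ is trace class. The Toeplitz symbols $c$ and $c_\mu$ of the Toeplitz parts of $C_{J\to\Delta}$ and $C^\mu_{J\to\Delta}$ are both analytic in the open unit disc $\mathbb D$. Furthermore, if $J^{[m]}$ ($m\ge1$) are the Toeplitz-plus-finite-rank approximations of $J$, with corresponding Toeplitz symbols $c^{[m]}$ and $c_\mu^{[m]}$, then $c^{[m]}\to c$ and $c_\mu^{[m]}\to c_\mu$ as $m\to\infty$ uniformly on compact subsets of $\mathbb D$.
   Context: All matrices are indexed from $0$. A Jacobi operator $J$ is a bounded self-adjoint operator on $\ell^2(\{0,1,2,\dots\})$ given by a symmetric tridiagonal matrix with real diagonal entries $J_{k,k}=\alpha_k$ and off-diagonal entries $J_{k,k+1}=J_{k+1,k}=\beta_k>0$. Its orthonormal polynomials are defined by $P_{-1}=0$, $P_0=1$, $sP_k(s)=\beta_{k-1}P_{k-1}(s)+\alpha_kP_k(s)+\beta_kP_{k+1}(s)$. Its first associated polynomials are defined by $P_0^\mu=0$, $P_1^\mu=\beta_0^{-1}$, and $sP^\mu_k(s)=\beta_{k-1}P^\mu_{k-1}(s)+\alpha_kP^\mu_k(s)+\beta_kP^\mu_{k+1}(s)$ for $k\ge1$. The free Jacobi operator $\Delta$ has diagonal entries $0$ and off-diagonal entries $\tfrac12$; its orthonormal polynomials are the Chebyshev polynomials of the second kind $U_k$. The matrices $C_{J\to\Delta}=(c_{i,j})$ and $C^\mu_{J\to\Delta}=(c^\mu_{i,j})$ are the upper triangular matrices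 defined by $P_k=\sum_{i=0}^kc_{i,k}U_i$ and $P^\mu_k=\sum_{i=0}^kc^\mu_{i,k}U_i$. That $K=J-\Delta$ is trace class means $\sum_{k\ge0}\left(|\alpha_k|+|\beta_k-\frac12|\right)<\infty$. In this case the limits $t_k=\lim_{i\to\infty}c_{i,i+k}$ and $t^\mu_k=\lim_{i\to\infty}c^\mu_{i,i+k}$ exist for every $k\ge0$; the Toeplitz parts of $C$ and $C^\mu$ are the upper triangular Toeplitz matrices with entries $t_{j-i}$ and $t^\mu_{j-i}$ ($j\ge i$), and their Toeplitz symbols are $c(z)=\sum_{k\ge0}t_kz^k$ and $c_\mu(z)=\sum_{k\ge0}t^\mu_kz^k$. The approximation $J^{[m]}$ is the Jacobi operator with $J^{[m]}_{i,j}=J_{i,j}$ if $0\le i,j<m$ and $J^{[m]}_{i,j}=\Delta_{i,j}$ otherwise; $c^{[m]}$ and $c^{[m]}_\mu$ are the functions obtained in the same way from $J^{[m]}$ (they are polynomials). *)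

(* Defs.v *)
From Stdlib Require Export Reals Arith Lra Lia List ClassicalEpsilon.
From Coquelicot Require Export Coquelicot.
Open Scope R_scope.

Definition ell2 (u : nat -> C) : Prop := ex_series (fun k => Cmod (u k) ^ 2).

Definition ell2_norm (u : nat -> C) : R :=
  sqrt (Series (fun k => Cmod (u k) ^ 2)).

(* Row [k] of a tridiagonal matrix vanishes beyond column [k + 1], so the
   finite sum below is the whole matrix-vector product. *)
Definition tridiag_apply (J : nat -> nat -> R) (u : nat -> C) (k : nat) : C :=
  sum_n (fun j => Cmult (RtoC (J k j)) (u j)) (S k).

(* A bounded operator given by a real symmetric matrix is self-adjoint. *)
Record is_jacobi (J : nat -> nat -> R) : Prop := {
  jacobi_sym : forall i j, J i j = J j i;
  jacobi_tridiag : forall i j, (S i < j)%nat -> J i j = 0;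
  jacobi_pos : forall k, 0 < J k (S k);
  jacobi_bounded : exists M : R, forall u : nat -> C, ell2 u ->
    ell2 (tridiag_apply J u) /\
    ell2_norm (tridiag_apply J u) <= M * ell2_norm u
}.

Definition free_jacobi (i j : nat) : R :=
  if Nat.eq_dec (S i) j then 1 / 2
  else if Nat.eq_dec i (S j) then 1 / 2
  else 0.

(* Only meaningful for symmetric tridiagonal [K]. *)
Definition trace_class (K : nat -> nat -> R) : Prop :=
  ex_series (fun k => Rabs (K k k) + Rabs (K k (S k))).

Definition truncation (J : nat -> nat -> R) (m i j : nat) : R :=
  if lt_dec i m then (if lt_dec j m then J i j else free_jacobi i j)
  else free_jacobi i j.

(* The two recursions below solve the three-term recurrence
   s P_k = J (k-1) k P_(k-1) + J k k P_k + J k (k+1) P_(k+1)  for P_(k+1),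
   which for [assoc_poly] is imposed for k >= 1 only. *)

Fixpoint orth_poly (J : nat -> nat -> R) (k : nat) (s : R) : R :=
  match k with
  | O => 1
  | S k' =>
      match k' with
      | O => (s - J 0%nat 0%nat) / J 0%nat 1%nat
      | S k'' =>
          ((s - J k' k') * orth_poly J k' s - J k'' k' * orth_poly J k'' s)
          / J k' (S k')
      end
  end.

Fixpoint assoc_poly (J : nat -> nat -> R) (k : nat) (s : R) : R :=
  match k with
  | O => 0
  | S k' =>
      match k' with
      | O => / J 0%nat 1%nat
      | S k'' =>
          ((s - J k' k') * assoc_poly J k' s - J k'' k' * assoc_poly J k'' s)
          / J k' (S k')
      end
  end.

Definition chebU : nat -> R -> R := orth_poly free_jacobi.

Definition is_connection (Q : nat -> R -> R) (c : nat -> nat -> R) : Prop :=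
  (forall i k, (k < i)%nat -> c i k = 0) /\
  (forall k s, Q k s = sum_n (fun i => c i k * chebU i s) k).

(* The matrix satisfying [is_connection Q]: see [connection_orth],
   [connection_assoc] and [is_connection_unique] for its existence and
   uniqueness. *)
Definition connection (Q : nat -> R -> R) : nat -> nat -> R :=
  epsilon (inhabits (fun _ _ => 0)) (is_connection Q).

Definition Cmat (J : nat -> nat -> R) : nat -> nat -> R :=
  connection (orth_poly J).

Definition Cmat_mu (J : nat -> nat -> R) : nat -> nat -> R :=
  connection (assoc_poly J).

Definition diag_limit (A : nat -> nat -> R) (k : nat) : R :=
  real (Lim_seq (fun i => A i (i + k)%nat)).

Definition toeplitz_part (A : nat -> nat -> R) (i j : nat) : R :=
  if le_dec i j then diag_limit A (j - i) else 0.

Definition symbol_coef (T : nat -> nat -> R) (k : nat) : C :=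
  RtoC (T 0%nat k).

Definition CSeries (a : nat -> C) : C :=
  (Series (fun k => Re (a k)), Series (fun k => Im (a k))).

(* Symbol of an upper triangular Toeplitz matrix [T]. *)
Definition symbol (T : nat -> nat -> R) (z : C) : C :=
  CSeries (fun k => Cmult (symbol_coef T k) (Cpow z k)).

Definition c_symbol (J : nat -> nat -> R) : C -> C :=
  symbol (toeplitz_part (Cmat J)).

Definition c_mu_symbol (J : nat -> nat -> R) : C -> C :=
  symbol (toeplitz_part (Cmat_mu J)).

Definition unit_disc (z : C) : Prop := Cmod z < 1.

(* The limits and the series are given by total operators; this says that they
   genuinely converge, the series on the whole open unit disc. *)
Definition symbol_well_defined (A : nat -> nat -> R) : Prop :=
  (forall k, ex_finite_lim_seq (fun i => A i (i + k)%nat)) /\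
  (forall z, unit_disc z ->
     @is_pseries C_AbsRing C_NormedModule
       (symbol_coef (toeplitz_part A)) z (symbol (toeplitz_part A) z)).

(* For an open set [D]. *)
Definition analytic_on (D : C -> Prop) (f : C -> C) : Prop :=
  forall z0, D z0 ->
  exists (r : R) (a : nat -> C), 0 < r /\
    forall z, Cmod (Cminus z z0) < r ->
      @is_pseries C_AbsRing C_NormedModule a (Cminus z z0) (f z).

Definition compact_set {T : UniformSpace} (E : T -> Prop) : Prop :=
  forall (I : Type) (V : I -> T -> Prop),
    (forall i, open (V i)) ->
    (forall z, E z -> exists i, V i z) ->
    exists l : list I, forall z, E z -> exists i, In i l /\ V i z.

Definition uniform_cv_on (E : C -> Prop) (F : nat -> C -> C) (f : C -> C)
  : Prop :=
  forall eps : R, 0 < eps ->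
  exists N : nat, forall m, (N <= m)%nat ->
    forall z, E z -> Cmod (Cminus (F m z) (f z)) < eps.

Definition uniform_cv_on_compacts (D : C -> Prop) (F : nat -> C -> C)
  (f : C -> C) : Prop :=
  forall E : C -> Prop, @compact_set C_UniformSpace E ->
    (forall z, E z -> D z) -> uniform_cv_on E F f.

Lemma free_jacobi_diag k : free_jacobi k k = 0.
Proof.
unfold free_jacobi; destruct (Nat.eq_dec (S k) k); [lia|].
now destruct (Nat.eq_dec k (S k)); [lia|].
Qed.

Lemma free_jacobi_super k : free_jacobi k (S k) = 1 / 2.
Proof. now unfold free_jacobi; destruct (Nat.eq_dec (S k) (S k)); [|lia]. Qed.

Lemma chebU_0 s : chebU 0 s = 1.
Proof. reflexivity. Qed.

Lemma chebU_1 s : chebU 1 s = 2 * s.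
Proof.
unfold chebU; cbn [orth_poly]; rewrite free_jacobi_diag, free_jacobi_super; field.
Qed.

Lemma chebU_SS k s : chebU (S (S k)) s = 2 * s * chebU (S k) s - chebU k s.
Proof.
unfold chebU.
change (orth_poly free_jacobi (S (S k)) s) with
  (((s - free_jacobi (S k) (S k)) * orth_poly free_jacobi (S k) s
    - free_jacobi k (S k) * orth_poly free_jacobi k s) / free_jacobi (S k) (S (S k))).
rewrite free_jacobi_diag, !free_jacobi_super; field.
Qed.

(* Multiplication by [s] in the basis [chebU]. *)
Definition shift_coef (v : nat -> R) (i : nat) : R :=
  (match i with O => 0 | S i' => v i' end + v (S i)) / 2.

Lemma shift_coef_sum (v : nat -> R) n s :
  (forall i, (n < i)%nat -> v i = 0) ->
  s * sum_n (fun i => v i * chebU i s) n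
  = sum_n (fun i => shift_coef v i * chebU i s) (S n).
Proof.
intros Hv.
assert (H : forall N,
  s * sum_n (fun i => v i * chebU i s) N
  + v (S N) / 2 * chebU N s + v (S (S N)) / 2 * chebU (S N) s
  = sum_n (fun i => shift_coef v i * chebU i s) (S N)).
{ induction N as [|N IH].
  - rewrite sum_Sn, !sum_O; unfold plus, shift_coef; simpl.
    rewrite chebU_0, chebU_1; field.
  - rewrite (sum_Sn (fun i => shift_coef v i * chebU i s) (S N)).
    rewrite (sum_Sn (fun i => v i * chebU i s) N).
    unfold plus in *; simpl in *.
    unfold shift_coef at 2.
    rewrite !chebU_SS in *; lra. }
specialize (H n).
rewrite (Hv (S n)), (Hv (S (S n))) in H by lia; lra.
Qed.

Lemma sum_comb3 (u v w : nat -> R) (x y d : R) (f : nat -> R) n :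
  sum_n (fun i => (u i - x * v i - y * w i) / d * f i) n
  = (sum_n (fun i => u i * f i) n - x * sum_n (fun i => v i * f i) n
     - y * sum_n (fun i => w i * f i) n) / d.
Proof.
induction n as [|n IH].
- rewrite !sum_O.
  match goal with |- ?a = ?b => change (@eq R a b) end.
  unfold Rdiv; ring.
- rewrite !sum_Sn, IH; unfold plus; simpl.
  match goal with |- ?a = ?b => change (@eq R a b) end.
  unfold Rdiv; ring.
Qed.

Fixpoint rec_coef (J : nat -> nat -> R) (q0 q1 : nat -> R) (k : nat)
  : (nat -> R) * (nat -> R) :=
  match k with
  | O => (q0, q1)
  | S k' =>
      let (v, w) := rec_coef J q0 q1 k' in
      (w, fun i => (shift_coef w i - J (S k') (S k') * w i - J k' (S k') * v i)
                   / J (S k') (S (S k')))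
  end.

Lemma rec_coef_spec (J : nat -> nat -> R) (Q : nat -> R -> R)
  (q0 q1 : nat -> R)
  (HQ0 : forall s, Q 0%nat s = sum_n (fun i => q0 i * chebU i s) 0)
  (HQ1 : forall s, Q 1%nat s = sum_n (fun i => q1 i * chebU i s) 1)
  (Hq0 : forall i, (0 < i)%nat -> q0 i = 0)
  (Hq1 : forall i, (1 < i)%nat -> q1 i = 0)
  (HQ : forall k s, Q (S (S k)) s
    = ((s - J (S k) (S k)) * Q (S k) s - J k (S k) * Q k s)
      / J (S k) (S (S k))) k :
  let rec_coef := rec_coef J q0 q1 in
  (forall i, (k < i)%nat -> fst (rec_coef k) i = 0) /\
  (forall i, (S k < i)%nat -> snd (rec_coef k) i = 0) /\
  (forall s, Q k s = sum_n (fun i => fst (rec_coef k) i * chebU i s) k) /\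
  (forall s, Q (S k) s = sum_n (fun i => snd (rec_coef k) i * chebU i s) (S k)).
Proof.
intros rc; unfold rc; clear rc.
induction k as [|k IH]; [now repeat split|].
destruct IH as (Hv & Hw & Sv & Sw); simpl.
destruct (rec_coef J q0 q1 k) as [v w]; simpl in *.
repeat split; trivial.
- intros i Hi; unfold shift_coef; destruct i as [|i]; [lia|].
  rewrite (Hw i), (Hw (S i)), (Hw (S (S i))), (Hv (S i)) by lia.
  unfold Rdiv; ring.
- intros s; rewrite HQ, Sw.
  assert (Ew : sum_n (fun i => w i * chebU i s) (S (S k))
               = sum_n (fun i => w i * chebU i s) (S k)).
  { rewrite sum_Sn, (Hw (S (S k))) by lia; unfold plus; simpl; ring. }
  assert (Ev : sum_n (fun i => v i * chebU i s) (S (S k))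
               = sum_n (fun i => v i * chebU i s) k).
  { rewrite !sum_Sn, (Hv (S (S k))), (Hv (S k)) by lia.
    unfold plus; simpl; ring. }
  rewrite Sv, <- Ev, Rmult_minus_distr_r, shift_coef_sum by exact Hw.
  rewrite <- Ew.
  now rewrite sum_comb3.
Qed.

Lemma connection_exists (J : nat -> nat -> R) (Q : nat -> R -> R)
  (q0 q1 : nat -> R)
  (HQ0 : forall s, Q 0%nat s = sum_n (fun i => q0 i * chebU i s) 0)
  (HQ1 : forall s, Q 1%nat s = sum_n (fun i => q1 i * chebU i s) 1)
  (Hq0 : forall i, (0 < i)%nat -> q0 i = 0)
  (Hq1 : forall i, (1 < i)%nat -> q1 i = 0)
  (HQ : forall k s, Q (S (S k)) s
    = ((s - J (S k) (S k)) * Q (S k) s - J k (S k) * Q k s)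
      / J (S k) (S (S k))) :
  exists c, is_connection Q c.
Proof.
exists (fun i k => fst (rec_coef J q0 q1 k) i); split.
- intros i k; now apply (rec_coef_spec J Q).
- intros k; now apply (rec_coef_spec J Q).
Qed.

Lemma connection_orth (J : nat -> nat -> R) :
  is_connection (orth_poly J) (Cmat J).
Proof.
unfold Cmat, connection; apply epsilon_spec.
apply (connection_exists J (orth_poly J)
  (fun i => match i with O => 1 | _ => 0 end)
  (fun i => match i with
            | O => - J 0%nat 0%nat / J 0%nat 1%nat
            | 1%nat => / (2 * J 0%nat 1%nat) | _ => 0 end)).
- intros s; rewrite sum_O, chebU_0; simpl; ring.
- intros s; rewrite sum_Sn, sum_O, chebU_0, chebU_1; unfold plus; simpl.
  unfold Rdiv; rewrite Rinv_mult; generalize (/ J 0%nat 1%nat); intros x; field.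
- intros [|i]; [lia|reflexivity].
- intros [|[|i]]; [lia|lia|reflexivity].
- reflexivity.
Qed.

Lemma connection_assoc (J : nat -> nat -> R) :
  is_connection (assoc_poly J) (Cmat_mu J).
Proof.
unfold Cmat_mu, connection; apply epsilon_spec.
apply (connection_exists J (assoc_poly J) (fun _ => 0)
  (fun i => match i with O => / J 0%nat 1%nat | _ => 0 end)).
- intros s; rewrite sum_O; simpl; ring.
- intros s; rewrite sum_Sn, sum_O, chebU_0; unfold plus; simpl; ring.
- reflexivity.
- intros [|[|i]]; [lia|lia|reflexivity].
- reflexivity.
Qed.

Lemma chebU_growth k s : 1 <= s ->
  0 < chebU k s /\ (2 * s - 1) * chebU k s <= chebU (S k) s.
Proof.
intros Hs; induction k as [|k [IH1 IH2]].
- rewrite chebU_0, chebU_1; lra.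
- assert (chebU k s <= chebU (S k) s) by nra.
  split; [lra|]; rewrite chebU_SS; lra.
Qed.

Lemma chebU_free (v : nat -> R) n :
  (forall s, sum_n (fun i => v i * chebU i s) n = 0) ->
  forall i, (i <= n)%nat -> v i = 0.
Proof.
assert (Hb : forall k, exists A, forall s, 1 <= s ->
  Rabs (sum_n (fun i => v i * chebU i s) k) <= A * chebU k s).
{ induction k as [|k [A HA]].
  - exists (Rabs (v 0%nat)); intros s _.
    rewrite sum_O, chebU_0, !Rmult_1_r; lra.
  - exists (Rabs A + Rabs (v (S k))); intros s Hs.
    rewrite sum_Sn; unfold plus; simpl.
    destruct (chebU_growth k s Hs) as [H1 H2].
    destruct (chebU_growth (S k) s Hs) as [H3 _].
    assert (chebU k s <= chebU (S k) s) by nra.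
    eapply Rle_trans; [apply Rabs_triang|].
    rewrite Rabs_mult, (Rabs_pos_eq (chebU (S k) s)) by lra.
    pose proof (HA s Hs); pose proof (Rle_abs A); pose proof (Rabs_pos A).
    nra. }
induction n as [|n IH]; intros H.
- intros i Hi; replace i with 0%nat by lia.
  specialize (H 0); rewrite sum_O, chebU_0 in H; lra.
- assert (Hn : v (S n) = 0).
  { destruct (Hb n) as [A HA].
    destruct (Req_dec (v (S n)) 0) as [E|E]; [exact E|exfalso].
    assert (Hpos := Rabs_pos_lt _ E).
    set (d := Rabs (v (S n))) in *.
    set (s := 1 + Rabs A / d).
    assert (Hq : 0 <= Rabs A / d).
    { apply Rmult_le_pos; [apply Rabs_pos|].
      left; now apply Rinv_0_lt_compat. }
    assert (Hs : 1 <= s) by (unfold s; lra).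
    destruct (chebU_growth n s Hs) as [H1 H2].
    assert (Hd : d * s = d + Rabs A) by (unfold s; field; lra).
    specialize (H s); rewrite sum_Sn in H; unfold plus in H; simpl in H.
    pose proof (HA s Hs) as HAs.
    replace (sum_n (fun i => v i * chebU i s) n)
      with (- (v (S n) * chebU (S n) s)) in HAs by lra.
    destruct (chebU_growth (S n) s Hs) as [H3 _].
    rewrite Rabs_Ropp, Rabs_mult, (Rabs_pos_eq (chebU (S n) s)) in HAs by lra.
    fold d in HAs.
    pose proof (Rle_abs A); pose proof (Rabs_pos A).
    assert (d * ((2 * s - 1) * chebU n s) <= A * chebU n s) by nra.
    assert ((d * (2 * s - 1) - A) * chebU n s <= 0) by lra.
    assert (0 < d * (2 * s - 1) - A) by lra.
    nra. }
  intros i Hi; destruct (Nat.eq_dec i (S n)) as [->|]; [exact Hn|].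
  apply IH; [|lia].
  intros s; specialize (H s); rewrite sum_Sn, Hn in H.
  unfold plus in H; simpl in H; lra.
Qed.

Lemma is_connection_unique Q c c' :
  is_connection Q c -> is_connection Q c' -> forall i k, c i k = c' i k.
Proof.
intros [H0 H] [H0' H'] i k.
destruct (le_lt_dec i k) as [Hi|Hi]; [|now rewrite H0, H0'].
apply Rminus_diag_uniq.
apply (chebU_free (fun i => c i k - c' i k) k); [|exact Hi].
intros s.
rewrite (sum_n_ext _
  (fun i => (c i k - 1 * c' i k - 0 * c i k) / 1 * chebU i s)).
- rewrite sum_comb3, <- H, <- H'.
  match goal with |- ?a = ?b => change (@eq R a b) end; field.
- intros j; match goal with |- ?a = ?b => change (@eq R a b) end; field.
Qed.

(* Main.v *)
Require Import Defs.
Open Scope R_scope.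

(* Write [E i k = c i k - c (i-1) (k-1)] for the steps along the diagonals of a
   connection matrix.  In terms of these the three-term recurrence reads
     2 b_(k+1) E i (k+2) = E (i+1) (k+1) + (perturbation terms) * (entries of c),
   so with the weight [r ^ (k - i)], [0 < r < 1], the unperturbed part contracts
   by [r ^ 2].  A discrete Gronwall argument then gives
   [|E i k| r ^ k <= d k r ^ i] with [d] summable, the same [d] serving for [J]
   and for all its truncations.  Hence [t_j = sum_i E i (i + j)] satisfies
   [|t_j| r ^ j <= sum d], and since the first [m] columns of the matrices of [J]
   and [J^[m]] agree, [|t_j - t_j^[m]| r ^ j <= 2 sum_(k >= m) d k].  Both claims
   follow by comparison with geometric series of ratio [|z| / r]. *)

(** * Tails and shifts of nonnegative real series *)

(** Zeroing the head rather than shifting keeps the indices in place, so a tail can be compared with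
    another sequence term by term. *)
Definition cut (b : nat -> R) (m k : nat) : R := if lt_dec k m then 0 else b k.

Lemma sum_n_le_Series (a : nat -> R) n :
  (forall k, 0 <= a k) -> ex_series a -> sum_n a n <= Series a.
Proof.
intros Ha Hs.
apply (is_lim_seq_incr_compare (sum_n a) (Series a)).
- exact (Series_correct a Hs).
- intros k; rewrite sum_Sn; unfold plus; simpl; specialize (Ha (S k)); lra.
Qed.

Lemma ex_series_bounded_nonneg (a : nat -> R) (M : R) :
  (forall k, 0 <= a k) -> (forall n, sum_n a n <= M) -> ex_series a.
Proof.
intros Ha HM.
destruct (ex_finite_lim_seq_incr (sum_n a) M) as [l Hl]; [|exact HM|].
- intros n; rewrite sum_Sn; unfold plus; simpl; specialize (Ha (S n)); lra.
- now exists l.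
Qed.

Lemma sum_n_ge_last (a : nat -> R) n : (forall k, 0 <= a k) -> a n <= sum_n a n.
Proof.
intros Ha; destruct n as [|n]; [rewrite sum_O; lra|].
rewrite sum_Sn; unfold plus; simpl.
assert (H : 0 <= sum_n a n).
{ induction n as [|n IH]; [rewrite sum_O; auto|].
  rewrite sum_Sn; unfold plus; simpl; specialize (Ha (S n)); lra. }
lra.
Qed.

Lemma sum_n_nonneg (a : nat -> R) n : (forall k, 0 <= a k) -> 0 <= sum_n a n.
Proof. intros Ha; eapply Rle_trans; [apply (Ha n)|now apply sum_n_ge_last]. Qed.

Lemma ex_series_cut (b : nat -> R) m :
  (forall k, 0 <= b k) -> ex_series b -> ex_series (cut b m).
Proof.
intros Hb Hs; apply (@ex_series_le R_AbsRing R_CompleteNormedModule _ b);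
  [|exact Hs].
intros n; unfold norm; simpl; unfold abs; simpl; unfold cut.
destruct (lt_dec n m); [rewrite Rabs_R0; auto|].
rewrite Rabs_pos_eq; auto; lra.
Qed.

Lemma Series_cut_small (b : nat -> R) (eps : R) :
  ex_series b -> 0 < eps ->
  exists N, forall m, (N <= m)%nat -> Series (cut b m) < eps.
Proof.
intros Hs He.
assert (Hl : is_lim_seq (sum_n b) (Series b)) by exact (Series_correct b Hs).
apply is_lim_seq_spec in Hl.
destruct (Hl (mkposreal eps He)) as [N HN]; simpl in HN.
(* With [S N] the index [m] is positive, so the tail from [m] is the total minus the partial sum
   through [pred m], and [N <= pred m]. *)
exists (S N); intros m Hm.
assert (E : Series (cut b m) = Series b - sum_n b (pred m)).
{ rewrite (Series_incr_n_aux (cut b m) m).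
  - rewrite (Series_incr_n b m) by (trivial; lia).
    rewrite (sum_n_Reals b).
    rewrite (Series_ext (fun k => cut b m (m + k)) (fun k => b (m + k)%nat)).
    + match goal with |- ?a = ?b => change (@eq R a b) end; ring.
    + intros k; unfold cut; destruct (lt_dec (m + k) m); [lia|reflexivity].
  - intros k Hk; unfold cut; destruct (lt_dec k m); [reflexivity|lia]. }
rewrite E; specialize (HN (pred m) ltac:(lia)).
apply Rabs_def2 in HN; lra.
Qed.

Lemma ex_series_shift (b : nat -> R) j :
  ex_series b -> ex_series (fun i => b (i + j)%nat).
Proof.
intros Hs; apply (ex_series_incr_n b j) in Hs.
apply (ex_series_ext _ _ (fun n => f_equal b (Nat.add_comm j n)) Hs).
Qed.

Lemma Series_shift_le (b : nat -> R) j :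
  (forall k, 0 <= b k) -> ex_series b ->
  Series (fun i => b (i + j)%nat) <= Series b.
Proof.
intros Hb; induction j as [|j IH]; intros Hs.
- right; apply Series_ext; intros n; f_equal; lia.
- rewrite <- IH by exact Hs.
  rewrite (Series_incr_1 (fun i => b (i + j)%nat)) by now apply ex_series_shift.
  simpl; rewrite (Series_ext (fun i => b (i + S j)%nat) (fun k => b (S (k + j)))).
  + specialize (Hb j); lra.
  + intros n; f_equal; lia.
Qed.

(** * Complex power series on the unit disc *)

Lemma is_series_Cmod_le (a : nat -> C) (b : nat -> R) (l : C) :
  @is_series C_AbsRing C_NormedModule a l ->
  (forall n, Cmod (a n) <= b n) -> ex_series b -> Cmod l <= Series b.
Proof.
intros Hl Hab Hb.
apply (is_lim_seq_le (fun n => Cmod (@sum_n C_AbelianMonoid a n)) (sum_n b)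
  (Cmod l) (Series b)).
- intros n; unfold sum_n.
  eapply Rle_trans; [apply (norm_sum_n_m (V := C_NormedModule))|].
  now apply sum_n_m_le.
- exact (filterlim_comp _ _ _ _ _ _ _ _ Hl (filterlim_norm (V := C_NormedModule) l)).
- exact (Series_correct b Hb).
Qed.

(** Absolute convergence and completeness provide some complex limit; its two projections are
    continuous, which identifies it with the pair of real sums in [CSeries]. *)
Lemma is_series_CSeries (a : nat -> C) (b : nat -> R) :
  (forall n, Cmod (a n) <= b n) -> ex_series b ->
  @is_series C_AbsRing C_NormedModule a (CSeries a).
Proof.
intros Hab Hb.
destruct (@ex_series_le C_AbsRing C_CompleteNormedModule a b Hab Hb) as [[l1 l2] Hl].
assert (Hre : forall n, fst (@sum_n C_AbelianMonoid a n) = sum_n (fun k => Re (a k)) n).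
{ induction n as [|n IH]; [now rewrite !sum_O|].
  rewrite !sum_Sn, <- IH; reflexivity. }
assert (Him : forall n, snd (@sum_n C_AbelianMonoid a n) = sum_n (fun k => Im (a k)) n).
{ induction n as [|n IH]; [now rewrite !sum_O|].
  rewrite !sum_Sn, <- IH; reflexivity. }
assert (E : CSeries a = (l1, l2)).
{ unfold CSeries; f_equal; apply is_series_unique.
  - apply (filterlim_ext _ _ Hre).
    exact (filterlim_comp _ _ _ _ _ _ _ _ Hl
      (@continuous_fst R_UniformSpace R_UniformSpace l1 l2)).
  - apply (filterlim_ext _ _ Him).
    exact (filterlim_comp _ _ _ _ _ _ _ _ Hl
      (@continuous_snd R_UniformSpace R_UniformSpace l1 l2)). }
rewrite E; exact Hl.
Qed.

Lemma is_pseries_CSeries (a : nat -> C) (z : C) (b : nat -> R) :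
  (forall n, Cmod (a n) * Cmod z ^ n <= b n) -> ex_series b ->
  @is_pseries C_AbsRing C_NormedModule a z (CSeries (fun k => Cmult (a k) (Cpow z k))).
Proof.
intros Hab Hb.
apply (is_series_ext (V := C_NormedModule) (fun k => Cmult (a k) (Cpow z k))).
- intros n; exact (Cmult_comm _ _).
- apply (is_series_CSeries _ b); [|exact Hb].
  intros n; rewrite Cmod_mult, Cmod_pow; apply Hab.
Qed.

(* [taylor z k n] is the coefficient of [h ^ n] in [(z + h) ^ k]. *)
Fixpoint taylor (z : C) (k n : nat) : C :=
  match k with
  | O => match n with O => 1 | S _ => 0 end
  | S k' => Cplus (Cmult z (taylor z k' n))
              (match n with O => 0 | S n' => taylor z k' n' end)
  end.

(** The recursion of [taylor] is Pascal's rule: one more factor [z + h] contributes [z] times the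
    old sum and [h] times the old sum with one term fewer. *)
Lemma sum_taylor (z h : C) k N : (k <= N)%nat ->
  @sum_n C_AbelianMonoid (fun n => Cmult (taylor z k n) (Cpow h n)) N = Cpow (Cplus z h) k.
Proof.
revert N; induction k as [|k IH]; intros N HN.
- induction N as [|N IHN]; [rewrite sum_O; simpl; ring|].
  rewrite sum_Sn, IHN by lia; unfold plus; simpl; ring.
- destruct N as [|N]; [lia|].
  set (u := fun n => Cmult (taylor z k n) (Cpow h n)) in *.
  assert (E : forall M, @sum_n C_AbelianMonoid (fun n => Cmult (taylor z (S k) n) (Cpow h n)) (S M)
    = Cplus (Cmult z (@sum_n C_AbelianMonoid u (S M))) (Cmult h (@sum_n C_AbelianMonoid u M))).
  { induction M as [|M IHM].
    - rewrite !sum_Sn, !sum_O; unfold plus, u; simpl; ring.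
    - rewrite (sum_Sn _ (S M)), IHM, (sum_Sn u (S M)), (sum_Sn u M).
      generalize (@sum_n C_AbelianMonoid u M); intros x.
      unfold plus, u; cbn [taylor Cpow]; simpl; ring. }
  rewrite E, !IH by lia; simpl; ring.
Qed.

(** Pascal's rule again, now with the triangle inequality. All terms are nonnegative, so lengthening
    the sum by one term, which the recursion needs, only increases it. *)
Lemma sum_Cmod_taylor (z : C) (H : R) k N : 0 <= H ->
  sum_n (fun n => Cmod (taylor z k n) * H ^ n) N <= (Cmod z + H) ^ k.
Proof.
intros HH; pose proof (Cmod_ge_0 z) as Hz.
assert (E : forall k M, sum_n (fun n => Cmod (taylor z (S k) n) * H ^ n) (S M)
    <= Cmod z * sum_n (fun n => Cmod (taylor z k n) * H ^ n) (S M)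
       + H * sum_n (fun n => Cmod (taylor z k n) * H ^ n) M).
{ clear k N.
  assert (Z : forall k, Cmod (taylor z (S k) 0) <= Cmod z * Cmod (taylor z k 0)).
  { intros k; simpl; rewrite <- Cmod_mult; right; f_equal; ring. }
  assert (Q : forall k n, Cmod (taylor z (S k) (S n)) * H ^ (S n)
     <= Cmod z * (Cmod (taylor z k (S n)) * H ^ (S n))
       + H * (Cmod (taylor z k n) * H ^ n)).
  { intros k n; cbn [taylor].
    pose proof (Cmod_triangle (Cmult z (taylor z k (S n))) (taylor z k n)) as T.
    rewrite Cmod_mult in T.
    pose proof (pow_le H (S n) HH) as P.
    apply Rmult_le_compat_r with (2 := T) in P.
    simpl pow in *; lra. }
  intros k; induction M as [|M IHM].
  - rewrite !sum_Sn, !sum_O; unfold plus; cbn [AbelianMonoid.plus]; simpl (H ^ 0).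
    specialize (Z k); specialize (Q k 0%nat); simpl in *; lra.
  - rewrite (sum_Sn _ (S M)).
    rewrite (sum_Sn (fun n => Cmod (taylor z k n) * H ^ n) (S M)).
    rewrite (sum_Sn (fun n => Cmod (taylor z k n) * H ^ n) M) in *.
    specialize (Q k (S M)); unfold plus in *; simpl AbelianMonoid.plus in *; simpl in *; lra. }
assert (Pos : forall k N, 0 <= sum_n (fun n => Cmod (taylor z k n) * H ^ n) N).
{ intros k' N'; induction N' as [|N' IH].
  - rewrite sum_O; apply Rmult_le_pos; [apply Cmod_ge_0|apply pow_le, HH].
  - rewrite sum_Sn; apply Rplus_le_le_0_compat; [exact IH|].
    apply Rmult_le_pos; [apply Cmod_ge_0|apply pow_le, HH]. }
assert (Mon : forall k N, sum_n (fun n => Cmod (taylor z k n) * H ^ n) N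
   <= sum_n (fun n => Cmod (taylor z k n) * H ^ n) (S N)).
{ intros k' N'; rewrite sum_Sn; unfold plus; simpl AbelianMonoid.plus.
  assert (0 <= Cmod (taylor z k' (S N')) * H ^ S N').
  { apply Rmult_le_pos; [apply Cmod_ge_0|apply pow_le, HH]. }
  simpl in *; lra. }
revert N; induction k as [|k IH]; intros N.
- right; induction N as [|N IHN].
  + rewrite sum_O; simpl; rewrite Cmod_1; ring.
  + rewrite sum_Sn, IHN; unfold plus; simpl; rewrite Cmod_0; ring.
- eapply Rle_trans; [apply Mon|]; eapply Rle_trans; [apply E|].
  pose proof (Rmult_le_compat_l _ _ _ Hz (IH (S N))).
  pose proof (Rmult_le_compat_l _ _ _ HH (IH N)).
  simpl pow; lra.
Qed.

(** Re-expansion at [z0]: writing [z = z0 + h] and expanding each power gives a double series that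
    converges absolutely as long as [|z0| + |h| < 1], and the new coefficients are its sums over
    [k]. *)
Lemma analytic_on_CSeries (a : nat -> C) :
  (forall rho, 0 <= rho < 1 -> ex_series (fun k => Cmod (a k) * rho ^ k)) ->
  analytic_on unit_disc (fun z => CSeries (fun k => Cmult (a k) (Cpow z k))).
Proof.
intros Ha z0 Hz0; unfold unit_disc in Hz0.
pose proof (Cmod_ge_0 z0) as Hz0'.
(* [H] is half the distance from [z0] to the unit circle, so [rho] stays below 1. *)
set (H := (1 - Cmod z0) / 2); set (rho := Cmod z0 + H).
assert (HH : 0 < H) by (unfold H; lra).
assert (Hrho : 0 <= rho < 1) by (unfold rho, H; lra).
specialize (Ha rho Hrho).
set (b := fun n => CSeries (fun k => Cmult (a k) (taylor z0 k n))).
assert (Hb : forall n, @is_series C_AbsRing C_NormedModule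
   (fun k => Cmult (a k) (taylor z0 k n)) (b n)).
{ intros n.
  apply (is_series_CSeries _ (fun k => Cmod (a k) * rho ^ k * / H ^ n));
    [|now apply ex_series_scal_r].
  intros k; rewrite Cmod_mult, Rmult_assoc.
  apply Rmult_le_compat_l; [apply Cmod_ge_0|].
  pose proof (pow_lt H n HH) as P.
  apply (Rmult_le_reg_r (H ^ n)); [exact P|].
  rewrite Rmult_assoc, Rinv_l, Rmult_1_r by lra.
  eapply Rle_trans; [|apply (sum_Cmod_taylor z0 H k n); lra].
  apply (sum_n_ge_last (fun n => Cmod (taylor z0 k n) * H ^ n)).
  intros m; apply Rmult_le_pos; [apply Cmod_ge_0|apply pow_le; lra]. }
exists H, b; split; [exact HH|]; intros z Hz.
set (h := Cminus z z0) in *.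
assert (Ez : Cplus z0 h = z) by (unfold h; ring).
assert (Hzr : Cmod z <= rho).
{ rewrite <- Ez; pose proof (Cmod_triangle z0 h); unfold rho; lra. }
pose proof (Cmod_ge_0 h) as Hh.
assert (Hf : @is_series C_AbsRing C_NormedModule (fun k => Cmult (a k) (Cpow z k))
   (CSeries (fun k => Cmult (a k) (Cpow z k)))).
{ apply (is_series_CSeries _ (fun k => Cmod (a k) * rho ^ k)); [|exact Ha].
  intros k; rewrite Cmod_mult, Cmod_pow.
  apply Rmult_le_compat_l; [apply Cmod_ge_0|apply pow_incr].
  split; [apply Cmod_ge_0|exact Hzr]. }
set (f := CSeries (fun k => Cmult (a k) (Cpow z k))) in *.
set (p := fun k N => @sum_n C_AbelianMonoid (fun n => Cmult (taylor z0 k n) (Cpow h n)) N).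
(* A partial sum in [n] is a finite combination of the series [b n], so the order of summation can
   be exchanged by linearity alone. *)
assert (HS : forall N, @is_series C_AbsRing C_NormedModule
   (fun k => Cmult (a k) (p k N)) (@sum_n C_AbelianMonoid (fun n => Cmult (Cpow h n) (b n)) N)).
{ induction N as [|N IH].
  - rewrite sum_O; apply (is_series_ext (V := C_NormedModule)
      (fun k => Cmult (Cpow h 0) (Cmult (a k) (taylor z0 k 0)))).
    + intros k; unfold p; rewrite sum_O; simpl; ring.
    + exact (is_series_scal_l (V := C_NormedModule) _ _ _ (Hb 0%nat)).
  - rewrite sum_Sn; apply (is_series_ext (V := C_NormedModule)
      (fun k => Cplus (Cmult (a k) (p k N))
          (Cmult (Cpow h (S N)) (Cmult (a k) (taylor z0 k (S N)))))).
    + intros k; unfold p; rewrite sum_Sn; unfold plus; simpl; ring.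
    + apply (is_series_plus (V := C_NormedModule)); [exact IH|].
      exact (is_series_scal_l (V := C_NormedModule) _ _ _ (Hb (S N))). }
assert (Hp : forall k N, Cmod (p k N) <= rho ^ k).
{ intros k N; unfold p, sum_n.
  eapply Rle_trans; [apply (norm_sum_n_m (V := C_NormedModule))|].
  apply Rle_trans with ((Cmod z0 + Cmod h) ^ k).
  - eapply Rle_trans; [|apply (sum_Cmod_taylor z0 (Cmod h) k N Hh)].
    apply sum_n_m_le; intros n.
    rewrite <- Cmod_pow, <- Cmod_mult; apply Rle_refl.
  - apply pow_incr; unfold rho; lra. }
(* The factor 2 accounts for [p k N] and [z ^ k], each at most [rho ^ k] in modulus. *)
set (t := fun k => 2 * (Cmod (a k) * rho ^ k)).
assert (Ht : forall k, 0 <= t k).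
{ intros k; unfold t; pose proof (Cmod_ge_0 (a k)).
  assert (0 <= rho ^ k) by (apply pow_le; lra). nra. }
assert (Htx : ex_series t) by exact (ex_series_scal_l 2 _ Ha).
(* The partial sum of order [N] of the new series differs from [f] only through
   the terms [k > N], because [p k N = z ^ k] for [k <= N]. *)
apply filterlim_locally; intros eps.
destruct (Series_cut_small t eps Htx (cond_pos eps)) as [N0 HN0].
exists N0; intros N HN; apply (C_NormedModule_mixin_compat1 f).
eapply Rle_lt_trans; [|apply (HN0 N HN)].
apply (is_series_Cmod_le _ _ _
  (is_series_minus (V := C_NormedModule) _ _ _ _ (HS N) Hf)); [|now apply ex_series_cut].
intros k; unfold cut; destruct (lt_dec k N) as [Hk|Hk].
- unfold p; rewrite sum_taylor, Ez by lia.
  match goal with |- Cmod ?u <= _ => replace u with (RtoC 0) end.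
  + rewrite Cmod_0; lra.
  + unfold plus, opp; simpl; ring.
- apply Rle_trans with (Cmod (a k) * Cmod (p k N) + Cmod (a k) * Cmod z ^ k).
  + rewrite <- Cmod_pow, <- !Cmod_mult, <- (Cmod_opp (Cmult (a k) (Cpow z k))).
    apply Cmod_triangle.
  + unfold t; specialize (Hp k N); pose proof (Cmod_ge_0 (a k)).
    assert (Cmod z ^ k <= rho ^ k).
    { apply pow_incr; split; [apply Cmod_ge_0|exact Hzr]. }
    nra.
Qed.

(** The open discs of radius [q < 1] centred at 0 cover the set; [rho] is the largest radius in a
    finite subcover, or 0 if the subcover is empty. *)
Lemma compact_unit_disc (E : C -> Prop) :
  @compact_set C_UniformSpace E -> (forall z, E z -> unit_disc z) ->
  exists rho, 0 <= rho < 1 /\ forall z, E z -> Cmod z <= rho.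
Proof.
intros HE HD.
destruct (HE {q : R | q < 1} (fun q z => Cmod z < proj1_sig q)) as [l Hl].
- intros [q Hq]; simpl.
  apply (open_comp (fun z : C_UniformSpace => Cmod z) (fun x => x < q)).
  + intros z _; exact (filterlim_norm (V := C_NormedModule) z).
  + apply open_lt.
- intros z Hz; specialize (HD z Hz); unfold unit_disc in HD.
  assert (Hq : (1 + Cmod z) / 2 < 1) by lra.
  exists (exist (fun q => q < 1) _ Hq); simpl; lra.
- assert (Hm : exists rho, 0 <= rho < 1 /\ forall q, In q l -> proj1_sig q <= rho).
  { clear Hl; induction l as [|[q Hq] l [rho [Hr IH]]].
    - exists 0; split; [lra|intros q []].
    - exists (Rmax q rho); split.
      + split; [apply Rle_trans with rho; [lra|apply Rmax_r]|].
        now apply Rmax_lub_lt.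
      + intros q' [<-|Hq']; [apply Rmax_l|].
        eapply Rle_trans; [now apply IH|apply Rmax_r]. }
  destruct Hm as [rho [Hr Hm]]; exists rho; split; [exact Hr|].
  intros z Hz; destruct (Hl z Hz) as [q [Hq Hq']].
  specialize (Hm q Hq); lra.
Qed.

(** * A discrete Gronwall inequality and the summable majorant *)

(** Each factor [1 + delta n] is at most [exp (delta n)], and the exponents add up to at most
    [Series delta]. *)
Lemma discrete_gronwall (u delta : nat -> R) :
  0 <= u O -> (forall n, 0 <= delta n) -> ex_series delta ->
  (forall n, u (S n) <= (1 + delta n) * u n) ->
  forall n, u (S n) <= u O * exp (Series delta).
Proof.
intros Hu Hd Hs H n.
apply Rle_trans with (u O * exp (sum_n delta n)).
- induction n as [|n IH].
  + rewrite sum_O; specialize (H O); pose proof (exp_ineq1_le (delta O)); nra.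
  + rewrite sum_Sn; unfold plus; simpl; rewrite exp_plus, <- Rmult_assoc.
    eapply Rle_trans; [apply H|].
    pose proof (exp_ineq1_le (delta (S n))) as H1.
    pose proof (Hd (S n)) as H2.
    pose proof (exp_pos (sum_n delta n)) as H3.
    apply Rle_trans with ((1 + delta (S n)) * (u O * exp (sum_n delta n))).
    * apply Rmult_le_compat_l; lra.
    * rewrite Rmult_comm; apply Rmult_le_compat_l; [|lra].
      apply Rmult_le_pos; lra.
- apply Rmult_le_compat_l; [exact Hu|].
  destruct (sum_n_le_Series delta n Hd Hs) as [Hx| ->]; [|lra].
  left; now apply exp_increasing.
Qed.

(* The pair [(d_n, d_0 + ... + d_n)]. *)
Fixpoint majorant (r A : R) (g e : nat -> R) (n : nat) : R * R :=
  match n with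
  | O => (A, A)
  | S n' =>
      let (d, s) := majorant r A g e n' in
      let d' := g n' * (r ^ 2 * d + e n' * s) in (d', s + d')
  end.

(* The energy [s_n + r^2 / (1 - r^2) d_n], with [s_n] the partial sums of [d],
   grows by a factor [1 + O(g_n - 1 + e_n)] at each step. *)
Lemma majorant_summable (r A : R) (g e : nat -> R) :
  0 < r < 1 -> 0 <= A -> (forall k, 1 <= g k) -> (forall k, 0 <= e k) ->
  ex_series (fun k => g k - 1) -> ex_series e ->
  exists d : nat -> R,
    d O = A /\ (forall k, 0 <= d k) /\ ex_series d /\
    forall k, d (S k) = g k * (r ^ 2 * d k + e k * sum_n d k).
Proof.
intros Hr HA Hg He Hgs Hes.
set (d := fun n => fst (majorant r A g e n)).
assert (Hs : forall n, snd (majorant r A g e n) = sum_n d n).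
{ induction n as [|n IH]; [now rewrite sum_O|].
  rewrite sum_Sn, <- IH; unfold d; simpl.
  now destruct (majorant r A g e n). }
assert (Hd : forall k, d (S k) = g k * (r ^ 2 * d k + e k * sum_n d k)).
{ intros k; rewrite <- Hs; unfold d; simpl.
  now destruct (majorant r A g e k). }
assert (Hp : forall n, 0 <= d n /\ 0 <= sum_n d n).
{ induction n as [|n [IH1 IH2]]; [rewrite sum_O; now split|].
  assert (0 <= d (S n)).
  { rewrite Hd; specialize (Hg n); specialize (He n).
    apply Rmult_le_pos; [lra|].
    apply Rplus_le_le_0_compat; apply Rmult_le_pos; trivial; nra. }
  rewrite sum_Sn; unfold plus; simpl; lra. }
exists d; split; [reflexivity|]; split; [apply Hp|]; split; [|exact Hd].
(* [lam] solves [(1 + lam) * r ^ 2 = lam]: the part of the new [d] inherited from the old one then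
   reproduces the term [lam * d n] of the energy, up to the factor [g n]. *)
set (lam := r ^ 2 / (1 - r ^ 2)).
assert (Hr2 : 0 < 1 - r ^ 2) by nra.
assert (Hlam : 0 <= lam).
{ apply Rmult_le_pos; [nra|left; now apply Rinv_0_lt_compat]. }
assert (Elam : (1 + lam) * r ^ 2 = lam) by (unfold lam; field; lra).
(* A uniform bound for [g], since each nonnegative term [g k - 1] is at most the whole sum. It makes
   [delta] below linear in [g k - 1] and [e k], hence summable. *)
set (B := 1 + Series (fun k => g k - 1)).
assert (HB : forall k, g k <= B).
{ intros k; unfold B.
  assert (Hg1 : forall k, 0 <= g k - 1) by (intros n; specialize (Hg n); lra).
  pose proof (sum_n_ge_last _ k Hg1).
  pose proof (sum_n_le_Series _ k Hg1 Hgs); lra. }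
set (delta := fun k => (g k - 1) + (1 + lam) * B * e k).
assert (HB0 : 0 <= B) by (specialize (HB O); specialize (Hg O); lra).
assert (Hdelta : forall k, 0 <= delta k).
{ intros k; unfold delta; specialize (Hg k); specialize (He k).
  assert (0 <= (1 + lam) * B) by (apply Rmult_le_pos; lra). nra. }
assert (Hds : ex_series delta).
{ apply (ex_series_plus (V := R_NormedModule)); [exact Hgs|].
  exact (ex_series_scal_l ((1 + lam) * B) e Hes). }
set (E := fun n => sum_n d n + lam * d n).
apply (ex_series_bounded_nonneg d (E O * exp (Series delta))); [apply Hp|].
intros n; destruct (Hp n) as [Hn1 Hn2]; destruct (Hp (S n)) as [Hn3 Hn4].
apply Rle_trans with (sum_n d (S n)); [rewrite sum_Sn; unfold plus; simpl; lra|].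
apply Rle_trans with (E (S n)); [unfold E; nra|].
apply discrete_gronwall; trivial.
- unfold E; rewrite sum_O; destruct (Hp O); nra.
- clear n Hn1 Hn2 Hn3 Hn4; intros n; destruct (Hp n) as [Hn1 Hn2].
  unfold E; rewrite sum_Sn; unfold plus; simpl AbelianMonoid.plus; rewrite Hd.
  set (s := sum_n d n) in *; specialize (Hg n); specialize (He n); specialize (HB n).
  replace (s + g n * (r ^ 2 * d n + e n * s) + lam * (g n * (r ^ 2 * d n + e n * s)))
    with (s * (1 + (1 + lam) * g n * e n) + g n * ((1 + lam) * r ^ 2) * d n) by ring.
  rewrite Elam.
  assert (H1 : (1 + lam) * g n * e n <= delta n).
  { unfold delta; assert ((1 + lam) * g n <= (1 + lam) * B)
      by (apply Rmult_le_compat_l; lra). nra. }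
  assert (H2 : g n <= 1 + delta n).
  { unfold delta; assert (0 <= (1 + lam) * B) by (apply Rmult_le_pos; lra). nra. }
  assert (H3 : 0 <= lam * d n) by now apply Rmult_le_pos.
  apply Rmult_le_compat_l with (r := s) in H1; [|exact Hn2].
  apply Rmult_le_compat_r with (1 := H3) in H2.
  lra.
Qed.

(** * Steps along the diagonals and their weighted bounds *)

(* Entry preceding [(i, k)] on its diagonal, with [0] outside the matrix. *)
Definition back (c : nat -> nat -> R) (i k : nat) : R :=
  match i, k with S i', S k' => c i' k' | _, _ => 0 end.

Definition diag_step (c : nat -> nat -> R) (i k : nat) : R := c i k - back c i k.

(** The polynomial recurrence read off coefficientwise in the basis [chebU], from column 2 on, where
    it has the same form for both polynomial families. *)
Definition three_term (J c : nat -> nat -> R) : Prop := forall i k,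
  J (S k) (S (S k)) * c i (S (S k))
  = shift_coef (fun i => c i (S k)) i - J (S k) (S k) * c i (S k)
    - J k (S k) * c i k.

(** In column [k + 1] the shift produces the rows [i - 1] and [i + 1]. The former is the [back]
    entry; the latter is its own step plus [c i k], and this [c i k] cancels the leading part of
    [2 * J k (S k) * c i k]. *)
Lemma three_term_diag_step J c : three_term J c -> forall i k,
  2 * J (S k) (S (S k)) * diag_step c i (S (S k))
  = (1 - 2 * J (S k) (S (S k))) * back c i (S (S k))
    + diag_step c (S i) (S k)
    - 2 * J (S k) (S k) * c i (S k)
    + (1 - 2 * J k (S k)) * c i k.
Proof.
intros H i k; specialize (H i k); unfold shift_coef in H.
unfold diag_step, back; destruct i as [|i]; simpl in *; lra.
Qed.

(** The weight [r ^ (k - i)] is multiplied out, which avoids subtraction on indices. The bound [d k]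
    depends on the column only, so summing along any diagonal uses each [d k] at most once. *)
Definition diag_dominated (r : R) (d : nat -> R) (c : nat -> nat -> R) : Prop :=
  forall i k, Rabs (diag_step c i k) * r ^ k <= d k * r ^ i.

(** An entry is the sum of the steps that precede it on its diagonal, where the weight [r ^ (k - i)]
    is constant. The restriction to columns up to [N] suits the induction on columns in which this
    is applied. *)
Lemma entry_le_sum_steps r d c N : 0 < r -> (forall k, 0 <= d k) ->
  (forall i k, (k <= N)%nat -> Rabs (diag_step c i k) * r ^ k <= d k * r ^ i) ->
  forall i k, (k <= N)%nat -> Rabs (c i k) * r ^ k <= sum_n d k * r ^ i.
Proof.
intros Hr Hd H i k; revert i.
assert (Hz : forall k i, (k <= N)%nat -> back c i k = 0 ->
  Rabs (c i k) * r ^ k <= sum_n d k * r ^ i).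
{ intros n i Hn E; specialize (H i n Hn); unfold diag_step in H.
  rewrite E, Rminus_0_r in H.
  eapply Rle_trans; [exact H|].
  apply Rmult_le_compat_r; [apply pow_le; lra|now apply sum_n_ge_last]. }
induction k as [|k IH]; intros i Hk; [apply Hz; now destruct i|].
destruct i as [|i]; [now apply Hz|].
specialize (H (S i) (S k) Hk); specialize (IH i ltac:(lia)).
unfold diag_step in H; simpl back in H.
rewrite sum_Sn; unfold plus; simpl AbelianMonoid.plus.
pose proof (Rabs_triang (c (S i) (S k) - c i k) (c i k)) as T.
replace (c (S i) (S k) - c i k + c i k) with (c (S i) (S k)) in T by ring.
apply Rmult_le_compat_r with (r := r ^ S k) in T; [|apply pow_le; lra].
apply Rmult_le_compat_l with (r := r) in IH; [|lra].
simpl pow in *; lra.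
Qed.

(** Induction on columns: the recurrence for steps bounds [2 * b] times the new step by exactly the
    bracket in the recursion of [d], and division by [2 * b] costs at most [g]. *)
Lemma diag_dominated_three_term J c r A g e d :
  0 < r < 1 -> (forall k, 0 < J k (S k)) ->
  (forall k, / (2 * J k (S k)) <= g k) ->
  (forall k, 1 <= g k) -> 2 <= e O ->
  (forall k, Rabs (1 - 2 * J (S k) (S (S k))) + 2 * Rabs (J (S k) (S k))
     + Rabs (1 - 2 * J k (S k)) <= e (S k)) ->
  d O = A -> (forall k, 0 <= d k) ->
  (forall k, d (S k) = g k * (r ^ 2 * d k + e k * sum_n d k)) ->
  (forall i k, (k < i)%nat -> c i k = 0) ->
  Rabs (c O O) <= A -> Rabs (c O 1%nat) <= A -> Rabs (c 1%nat 1%nat) <= A ->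
  three_term J c -> diag_dominated r d c.
Proof.
intros Hr HJ HgJ Hg He0 He Hd0 Hdp Hd Hc H00 H01 H11 Hrec.
assert (HA : 0 <= A) by (pose proof (Rabs_pos (c O O)); lra).
assert (H0 : forall i, Rabs (diag_step c i 0) * r ^ 0 <= d O * r ^ i).
{ intros i; unfold diag_step, back; rewrite Hd0.
  destruct i as [|i]; [simpl; rewrite Rminus_0_r; lra|].
  rewrite (Hc (S i) O) by lia.
  rewrite Rminus_0_r, Rabs_R0, Rmult_0_l.
  apply Rmult_le_pos; [exact HA|apply pow_le; lra]. }
(* Column 1 is initial data, outside the recurrence; its step [c 1 1 - c 0 0] can reach [2 * A],
   which is why [e 0] must be at least 2. *)
assert (Hd1 : 2 * A <= d 1%nat).
{ rewrite Hd, sum_O, Hd0; specialize (Hg O).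
  assert (2 * A <= e O * A) by nra.
  assert (0 <= r ^ 2 * A) by (apply Rmult_le_pos; [nra|exact HA]).
  nra. }
assert (H1 : forall i, Rabs (diag_step c i 1) * r ^ 1 <= d 1%nat * r ^ i).
{ intros [|[|i]]; unfold diag_step, back; simpl pow.
  - rewrite Rminus_0_r; pose proof (Rabs_pos (c O 1%nat)).
    assert (Rabs (c O 1%nat) * r <= Rabs (c O 1%nat)) by nra.
    lra.
  - apply Rmult_le_compat_r; [lra|].
    unfold Rminus; eapply Rle_trans; [apply Rabs_triang|].
    rewrite Rabs_Ropp; lra.
  - rewrite !Hc, Rminus_0_r, Rabs_R0, Rmult_0_l by lia.
    apply Rmult_le_pos; [auto|]; apply (pow_le r (S (S i))); lra. }
assert (Hboth : forall n i k, (k <= n)%nat ->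
  Rabs (diag_step c i k) * r ^ k <= d k * r ^ i).
{ induction n as [|n IH]; intros i k Hk.
  { replace k with O by lia; apply H0. }
  destruct (Nat.eq_dec k (S n)) as [->|Hne]; [|apply IH; lia].
  destruct n as [|n]; [apply H1|].
  assert (Hent := entry_le_sum_steps r d c (S n) ltac:(lra) Hdp IH).
  set (s := sum_n d (S n)) in *.
  assert (Hs : sum_n d n <= s).
  { unfold s; rewrite sum_Sn; unfold plus; simpl; specialize (Hdp (S n)); lra. }
  assert (Hs0 : 0 <= sum_n d n) by now apply sum_n_nonneg.
  assert (Hri : 0 <= r ^ i) by (apply pow_le; lra).
  (* The three entries with perturbation coefficients ([B1], [B3], [B4]) are bounded through [s];
     any surplus power of [r] is bounded by 1. *)
  assert (B1 : Rabs (back c i (S (S n))) * r ^ S (S n) <= s * r ^ i).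
  { destruct i as [|i]; simpl back.
    - rewrite Rabs_R0; simpl; lra.
    - specialize (Hent i (S n) (le_n _)); fold s in Hent; simpl pow in *.
      apply Rmult_le_compat_l with (r := r) in Hent; lra. }
  (* From [(i, n + 2)] to [(i + 1, n + 1)] the distance to the main diagonal drops by 2. This is the
     source of the contraction factor [r ^ 2]. *)
  assert (B2 : Rabs (diag_step c (S i) (S n)) * r ^ S (S n) <= r ^ 2 * d (S n) * r ^ i).
  { specialize (IH (S i) (S n) (le_n _)); simpl pow in *.
    apply Rmult_le_compat_l with (r := r) in IH; lra. }
  assert (B3 : Rabs (c i (S n)) * r ^ S (S n) <= s * r ^ i).
  { specialize (Hent i (S n) (le_n _)); fold s in Hent.
    apply Rmult_le_compat_l with (r := r) in Hent; [|lra].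
    assert (0 <= s * r ^ i) by (apply Rmult_le_pos; lra).
    change (r ^ S (S n)) with (r * r ^ S n); nra. }
  assert (B4 : Rabs (c i n) * r ^ S (S n) <= s * r ^ i).
  { specialize (Hent i n ltac:(lia)).
    assert (0 <= sum_n d n * r ^ i) by (apply Rmult_le_pos; lra).
    assert (sum_n d n * r ^ i <= s * r ^ i) by (apply Rmult_le_compat_r; lra).
    assert (Hr2 : 0 <= r ^ 2 <= 1) by nra.
    apply Rmult_le_compat_l with (r := r ^ 2) in Hent; [|lra].
    change (r ^ S (S n)) with (r * (r * r ^ n)); simpl pow in *; nra. }
  assert (Hb := HJ (S n)); assert (E := three_term_diag_step J c Hrec i n).
  assert (HgJn := HgJ (S n)); assert (Hen := He n).
  set (b := J (S n) (S (S n))) in *.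
  assert (HX : 2 * b * Rabs (diag_step c i (S (S n))) * r ^ S (S n)
     <= (r ^ 2 * d (S n) + e (S n) * s) * r ^ i).
  { rewrite <- (Rabs_pos_eq (2 * b)), <- Rabs_mult, E by lra.
    assert (Hp : 0 <= r ^ S (S n)) by (apply pow_le; lra).
    assert (T : forall x y z w, Rabs (x + y - z + w) <= Rabs x + Rabs y + Rabs z + Rabs w).
    { intros x y z w; unfold Rabs; repeat destruct Rcase_abs; lra. }
    eapply Rle_trans; [apply Rmult_le_compat_r; [exact Hp|apply T]|].
    rewrite !Rabs_mult, (Rabs_pos_eq 2) by lra.
    apply Rmult_le_compat_l with (r := Rabs (1 - 2 * b)) in B1; [|apply Rabs_pos].
    apply Rmult_le_compat_l with (r := 2 * Rabs (J (S n) (S n))) in B3;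
      [|pose proof (Rabs_pos (J (S n) (S n))); lra].
    apply Rmult_le_compat_l with (r := Rabs (1 - 2 * J n (S n))) in B4; [|apply Rabs_pos].
    assert (Hsr : 0 <= s * r ^ i) by (apply Rmult_le_pos; lra).
    apply Rmult_le_compat_r with (1 := Hsr) in Hen.
    lra. }
  rewrite Hd; fold s.
  set (Y := (r ^ 2 * d (S n) + e (S n) * s)) in *.
  assert (HY : 0 <= Y).
  { apply Rplus_le_le_0_compat; apply Rmult_le_pos; auto; [nra| |lra].
    eapply Rle_trans; [|exact Hen].
    pose proof (Rabs_pos (1 - 2 * b)); pose proof (Rabs_pos (J (S n) (S n)));
    pose proof (Rabs_pos (1 - 2 * J n (S n))); lra. }
  apply Rle_trans with (/ (2 * b) * (Y * r ^ i)).
  - apply (Rmult_le_reg_l (2 * b)); [lra|].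
    rewrite <- (Rmult_assoc (2 * b) (/ (2 * b))), Rinv_r by lra; lra.
  - rewrite (Rmult_assoc (g (S n))); apply Rmult_le_compat_r; [|exact HgJn].
    now apply Rmult_le_pos. }
intros i k; apply (Hboth k); lia.
Qed.

(** * Limits along the diagonals *)

Lemma sum_diag_step c j n :
  sum_n (fun i => diag_step c i (i + j)) n = c n (n + j)%nat.
Proof.
induction n as [|n IH].
- rewrite sum_O; unfold diag_step; simpl; apply Rminus_0_r.
- rewrite sum_Sn, IH; unfold diag_step, plus; simpl.
  match goal with |- ?a = ?b => change (@eq R a b) end; ring.
Qed.

Lemma diag_dominated_step r d c i j : 0 < r -> diag_dominated r d c ->
  Rabs (diag_step c i (i + j)) * r ^ j <= d (i + j)%nat.
Proof.
intros Hr H; specialize (H i (i + j)%nat); rewrite pow_add in H.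
assert (P : 0 < r ^ i) by now apply pow_lt.
apply (Rmult_le_reg_l (r ^ i)); [exact P|]; lra.
Qed.

Lemma ex_series_diag_step r d c j : 0 < r -> ex_series d ->
  diag_dominated r d c -> ex_series (fun i => diag_step c i (i + j)).
Proof.
intros Hr Hds H.
apply (@ex_series_le R_AbsRing R_CompleteNormedModule _
  (fun i => d (i + j)%nat * / r ^ j)).
- intros i; change (Rabs (diag_step c i (i + j)) <= d (i + j)%nat * / r ^ j).
  pose proof (diag_dominated_step r d c i j Hr H) as Hi.
  assert (P : 0 < r ^ j) by now apply pow_lt.
  apply (Rmult_le_reg_r (r ^ j)); [exact P|].
  rewrite Rmult_assoc, Rinv_l by lra; lra.
- apply ex_series_scal_r; now apply ex_series_shift.
Qed.

(** The entries of a diagonal are the partial sums of its steps, so summability of the steps makes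
    [Lim_seq] return a genuine finite limit. *)
Lemma diag_limit_Series r d c j : 0 < r -> ex_series d ->
  diag_dominated r d c ->
  is_lim_seq (fun i => c i (i + j)%nat) (diag_limit c j) /\
  diag_limit c j = Series (fun i => diag_step c i (i + j)).
Proof.
intros Hr Hds H.
assert (L : is_lim_seq (fun i => c i (i + j)%nat)
   (Series (fun i => diag_step c i (i + j)))).
{ apply (is_lim_seq_ext _ _ _ (sum_diag_step c j)).
  exact (Series_correct _ (ex_series_diag_step r d c j Hr Hds H)). }
assert (E : diag_limit c j = Series (fun i => diag_step c i (i + j))).
{ unfold diag_limit; now rewrite (is_lim_seq_unique _ _ L). }
now rewrite E.
Qed.

Lemma Rabs_Series_le (u v : nat -> R) :
  (forall n, Rabs (u n) <= v n) -> ex_series v -> Rabs (Series u) <= Series v.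
Proof.
intros Huv Hv.
assert (Ha : ex_series (fun n => Rabs (u n))).
{ apply (@ex_series_le R_AbsRing R_CompleteNormedModule _ v); [|exact Hv].
  intros n; change (Rabs (Rabs (u n)) <= v n); now rewrite Rabs_Rabsolu. }
eapply Rle_trans; [now apply Series_Rabs|].
apply Series_le; [|exact Hv].
intros n; split; [apply Rabs_pos|apply Huv].
Qed.

Lemma diag_limit_bound r d c j : 0 < r -> (forall k, 0 <= d k) -> ex_series d ->
  diag_dominated r d c -> Rabs (diag_limit c j) * r ^ j <= Series d.
Proof.
intros Hr Hd Hds H.
assert (P : 0 < r ^ j) by now apply pow_lt.
destruct (diag_limit_Series r d c j Hr Hds H) as [_ ->].
rewrite <- (Rabs_pos_eq (r ^ j)), <- Rabs_mult, <- Series_scal_r by lra.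
eapply Rle_trans; [|apply (Series_shift_le d j Hd Hds)].
apply Rabs_Series_le; [|now apply ex_series_shift].
intros i; rewrite Rabs_mult, (Rabs_pos_eq (r ^ j)) by lra.
now apply diag_dominated_step.
Qed.

(** Steps in columns below [m] coincide, as the preceding entry lies in a smaller column still; in
    every other column each of the two steps is at most [d], whence the factor 2. *)
Lemma diag_limit_close r d c c' m j : 0 < r -> (forall k, 0 <= d k) ->
  ex_series d -> diag_dominated r d c -> diag_dominated r d c' ->
  (forall i k, (k < m)%nat -> c' i k = c i k) ->
  Rabs (diag_limit c' j - diag_limit c j) * r ^ j <= 2 * Series (cut d m).
Proof.
intros Hr Hd Hds H H' Hcc'.
assert (P : 0 < r ^ j) by now apply pow_lt.
assert (Hcut : forall k, 0 <= cut d m k).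
{ intros k; unfold cut; destruct (lt_dec k m); [lra|apply Hd]. }
assert (Hcs := ex_series_cut d m Hd Hds).
destruct (diag_limit_Series r d c j Hr Hds H) as [_ ->].
destruct (diag_limit_Series r d c' j Hr Hds H') as [_ ->].
rewrite <- Series_minus by now apply (ex_series_diag_step r d).
rewrite <- (Rabs_pos_eq (r ^ j)), <- Rabs_mult, <- Series_scal_r by lra.
apply Rle_trans with (Series (fun i => 2 * cut d m (i + j)%nat)).
- apply Rabs_Series_le; [|exact (ex_series_scal_l 2 _ (ex_series_shift (cut d m) j Hcs))].
  intros i; rewrite Rabs_mult, (Rabs_pos_eq (r ^ j)) by lra.
  unfold cut; destruct (lt_dec (i + j) m) as [Hk|Hk].
  + replace (diag_step c' i (i + j) - diag_step c i (i + j)) with 0.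
    * rewrite Rabs_R0; lra.
    * unfold diag_step; rewrite Hcc' by exact Hk.
      replace (back c' i (i + j)) with (back c i (i + j)); [ring|].
      destruct i as [|i]; [reflexivity|]; simpl; symmetry; apply Hcc'; lia.
  + pose proof (diag_dominated_step r d c i j Hr H) as B.
    pose proof (diag_dominated_step r d c' i j Hr H') as B'.
    unfold Rminus.
    pose proof (Rabs_triang (diag_step c' i (i + j)) (- diag_step c i (i + j))) as T.
    rewrite Rabs_Ropp in T.
    apply Rmult_le_compat_r with (r := r ^ j) in T; lra.
- rewrite Series_scal_l; apply Rmult_le_compat_l; [lra|].
  now apply Series_shift_le.
Qed.

(** * Connection matrices as solutions of the recurrence *)

(* Prescribing the first two columns (values [x], [y0], [y1]) makes the recurrence
   determine the whole matrix, for [orth_poly] and [assoc_poly] alike. *)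
Record solution (J : nat -> nat -> R) (x y0 y1 : R) (c : nat -> nat -> R)
  : Prop := {
  solution_three_term : three_term J c;
  solution_upper : forall i k, (k < i)%nat -> c i k = 0;
  solution_00 : c O O = x;
  solution_01 : c O 1%nat = y0;
  solution_11 : c 1%nat 1%nat = y1
}.

(** Uniqueness of connection coefficients identifies [c] with the matrix built by [rec_coef], whose
    columns obey the recurrence by construction. *)
Lemma connection_solution (J : nat -> nat -> R) (Q : nat -> R -> R)
  (q0 q1 : nat -> R) (c : nat -> nat -> R) :
  (forall k, 0 < J k (S k)) ->
  (forall s, Q 0%nat s = sum_n (fun i => q0 i * chebU i s) 0) ->
  (forall s, Q 1%nat s = sum_n (fun i => q1 i * chebU i s) 1) ->
  (forall i, (0 < i)%nat -> q0 i = 0) ->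
  (forall i, (1 < i)%nat -> q1 i = 0) ->
  (forall k s, Q (S (S k)) s
    = ((s - J (S k) (S k)) * Q (S k) s - J k (S k) * Q k s)
      / J (S k) (S (S k))) ->
  is_connection Q c -> solution J (q0 O) (q1 O) (q1 1%nat) c.
Proof.
intros HJ HQ0 HQ1 Hq0 Hq1 HQ Hc.
assert (Hr : is_connection Q (fun i k => fst (rec_coef J q0 q1 k) i)).
{ split; [intros i k|intros k];
    apply (rec_coef_spec J Q q0 q1 HQ0 HQ1 Hq0 Hq1 HQ k). }
assert (E := is_connection_unique _ _ _ Hc Hr); simpl in E.
split.
- intros i k; unfold shift_coef.
  assert (Hp : J (S k) (S (S k)) <> 0) by (specialize (HJ (S k)); lra).
  destruct i as [|i]; rewrite !E; simpl;
    destruct (rec_coef J q0 q1 k) as [v w]; simpl; unfold shift_coef; field; exact Hp.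
- apply Hc.
- now rewrite E.
- now rewrite E.
- now rewrite E.
Qed.

(** The second column comes from [P_1 = (s - J 0 0) / J 0 1] and [s = U_1 / 2]. *)
Lemma orth_solution (J : nat -> nat -> R) : (forall k, 0 < J k (S k)) ->
  solution J 1 (- J 0%nat 0%nat / J 0%nat 1%nat) (/ (2 * J 0%nat 1%nat)) (Cmat J).
Proof.
intros HJ.
apply (connection_solution J (orth_poly J)
  (fun i => match i with O => 1 | _ => 0 end)
  (fun i => match i with
            | O => - J 0%nat 0%nat / J 0%nat 1%nat
            | 1%nat => / (2 * J 0%nat 1%nat) | _ => 0 end)); trivial.
- intros s; rewrite sum_O, chebU_0; simpl; ring.
- intros s; rewrite sum_Sn, sum_O, chebU_0, chebU_1; unfold plus; simpl.
  field; specialize (HJ O); lra.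
- intros [|i]; [lia|reflexivity].
- intros [|[|i]]; [lia|lia|reflexivity].
- apply connection_orth.
Qed.

Lemma assoc_solution (J : nat -> nat -> R) : (forall k, 0 < J k (S k)) ->
  solution J 0 (/ J 0%nat 1%nat) 0 (Cmat_mu J).
Proof.
intros HJ.
apply (connection_solution J (assoc_poly J) (fun _ => 0)
  (fun i => match i with O => / J 0%nat 1%nat | _ => 0 end)); trivial.
- intros s; rewrite sum_O; simpl; ring.
- intros s; rewrite sum_Sn, sum_O, chebU_0; unfold plus; simpl; ring.
- intros [|[|i]]; [lia|lia|reflexivity].
- apply connection_assoc.
Qed.

(** * Truncations and a common majorant *)

Lemma truncation_diag J m k :
  truncation J m k k = if lt_dec k m then J k k else 0.
Proof.
unfold truncation; destruct (lt_dec k m); [reflexivity|apply free_jacobi_diag].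
Qed.

Lemma truncation_super J m k :
  truncation J m k (S k) = if lt_dec (S k) m then J k (S k) else 1 / 2.
Proof.
unfold truncation; destruct (lt_dec k m), (lt_dec (S k) m); try lia;
  trivial; apply free_jacobi_super.
Qed.

(** The recurrence for column [k] reads only entries of [J] with both indices at most [k], and
    truncation preserves these when [k < m]. *)
Lemma solution_truncation_eq J m x y0 y1 c c' : (2 <= m)%nat ->
  (forall k, 0 < J k (S k)) ->
  solution J x y0 y1 c -> solution (truncation J m) x y0 y1 c' ->
  forall i k, (k < m)%nat -> c' i k = c i k.
Proof.
intros Hm HJ Hc Hc'.
assert (H : forall n i k, (k <= S n)%nat -> (k < m)%nat -> c' i k = c i k).
{ induction n as [|n IH]; intros i k Hk Hkm.
  - destruct k as [|[|k]]; [| |lia]; destruct i as [|[|i]];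
      rewrite ?(solution_00 _ _ _ _ _ Hc), ?(solution_00 _ _ _ _ _ Hc'),
        ?(solution_01 _ _ _ _ _ Hc), ?(solution_01 _ _ _ _ _ Hc'),
        ?(solution_11 _ _ _ _ _ Hc), ?(solution_11 _ _ _ _ _ Hc');
      trivial;
      rewrite (solution_upper _ _ _ _ _ Hc), (solution_upper _ _ _ _ _ Hc');
      trivial; lia.
  - destruct (Nat.eq_dec k (S (S n))) as [->|Hne]; [|apply IH; lia].
    pose proof (solution_three_term _ _ _ _ _ Hc i n) as R.
    pose proof (solution_three_term _ _ _ _ _ Hc' i n) as R'.
    rewrite !truncation_super, truncation_diag in R'.
    destruct (lt_dec (S (S n)) m), (lt_dec (S n) m); try lia.
    assert (E : shift_coef (fun i => c' i (S n)) i = shift_coef (fun i => c i (S n)) i).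
    { unfold shift_coef; destruct i as [|i]; rewrite !IH by lia; reflexivity. }
    rewrite E, (IH i (S n)), (IH i n) in R' by lia.
    specialize (HJ (S n)).
    apply (Rmult_eq_reg_l (J (S n) (S (S n)))); lra. }
intros i k Hk; apply (H k); lia.
Qed.

(* One summable [d] dominates the solutions for [J] and for all its truncations,
   since truncating only replaces perturbation terms by [0]. *)
Lemma diag_dominated_uniform J K r x y0 y1 :
  0 < r < 1 -> (forall k, 0 < J k (S k)) ->
  (forall i j, J i j = free_jacobi i j + K i j) -> trace_class K ->
  exists d, (forall k, 0 <= d k) /\ ex_series d /\
    (forall c, solution J x y0 y1 c -> diag_dominated r d c) /\
    (forall m c, solution (truncation J m) x y0 y1 c -> diag_dominated r d c).
Proof.
intros Hr HJ HJK HK.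
assert (Ha : forall k, J k k = K k k).
{ intros k; rewrite HJK, free_jacobi_diag; ring. }
assert (Hb : forall k, J k (S k) = 1 / 2 + K k (S k)).
{ intros k; rewrite HJK, free_jacobi_super; ring. }
set (w := fun k => Rabs (K k k) + Rabs (K k (S k))).
assert (Hw : ex_series w) by exact HK.
(* This [g] is above both [/ (2 * J k (S k))] and 1, the latter being the value for the free entry
   [1 / 2], so it serves every truncation too. *)
set (g := fun k => 1 + Rabs (/ (2 * J k (S k)) - 1)).
set (e := fun k => match k with O => 2 | S k' =>
   Rabs (1 - 2 * J (S k') (S (S k'))) + 2 * Rabs (J (S k') (S k'))
     + Rabs (1 - 2 * J k' (S k')) end).
assert (Habs : forall k, Rabs (1 - 2 * J k (S k)) = 2 * Rabs (K k (S k))).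
{ intros k; rewrite Hb; replace (1 - 2 * (1 / 2 + K k (S k))) with (- (2 * K k (S k))) by field.
  rewrite Rabs_Ropp, Rabs_mult, (Rabs_pos_eq 2); lra. }
assert (Hes : ex_series e).
{ apply ex_series_incr_1.
  apply (@ex_series_le R_AbsRing R_CompleteNormedModule _
    (fun k => 2 * w (S k) + 2 * w k)).
  - intros k; change (Rabs (e (S k)) <= 2 * w (S k) + 2 * w k).
    unfold e, w; rewrite !Habs, Ha.
    pose proof (Rabs_pos (K k k)); pose proof (Rabs_pos (K k (S k)));
    pose proof (Rabs_pos (K (S k) (S k))); pose proof (Rabs_pos (K (S k) (S (S k)))).
    rewrite Rabs_pos_eq; lra.
  - apply (ex_series_plus (V := R_NormedModule)).
    + apply (ex_series_scal_l 2 (fun k => w (S k))); now apply ex_series_incr_1 in Hw.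
    + exact (ex_series_scal_l 2 w Hw). }
assert (Hgs : ex_series (fun k => g k - 1)).
{ pose proof (ex_series_lim_0 w Hw) as L; apply is_lim_seq_spec in L.
  (* Once [w] is below [1 / 4], the off-diagonal entry [b = 1 / 2 + q] is at least [1 / 4], and
     [/ (2 * b) - 1 = - q / b] is at most [4 * |q|] in absolute value. The finitely many earlier
     indices do not affect summability. *)
  assert (H4 : 0 < 1 / 4) by lra.
  destruct (L (mkposreal _ H4)) as [N HN]; simpl in HN.
  apply (ex_series_incr_n _ N).
  apply (@ex_series_le R_AbsRing R_CompleteNormedModule _
    (fun k => 4 * w (N + k)%nat)).
  - intros k; change (Rabs (g (N + k)%nat - 1) <= 4 * w (N + k)%nat).
    specialize (HN (N + k)%nat ltac:(lia)).
    specialize (HJ (N + k)%nat); specialize (Hb (N + k)%nat).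
    unfold g, w in *.
    set (b := J (N + k)%nat (S (N + k))) in *.
    set (q := K (N + k)%nat (S (N + k))) in *.
    set (p := Rabs (K (N + k)%nat (N + k)%nat)) in *.
    assert (Hp : 0 <= p) by apply Rabs_pos.
    pose proof (Rabs_pos q) as Hq.
    rewrite Rminus_0_r, Rabs_pos_eq in HN by lra.
    assert (Hb4 : 1 / 4 <= b).
    { assert (- (1 / 4) < q) by (apply Rabs_def2; lra). lra. }
    replace (1 + Rabs (/ (2 * b) - 1) - 1) with (Rabs (/ (2 * b) - 1)) by ring.
    rewrite Rabs_Rabsolu.
    replace (/ (2 * b) - 1) with (- q * / b).
    2:{ replace q with (b - 1 / 2) by lra; field; lra. }
    rewrite Rabs_mult, Rabs_Ropp, Rabs_inv, (Rabs_pos_eq b) by lra.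
    assert (/ b <= 4).
    { replace 4 with (/ (1 / 4)) by field; apply Rinv_le_contravar; lra. }
    nra.
  - apply (ex_series_scal_l 4 (fun k => w (N + k)%nat)).
    now apply ex_series_incr_n. }
set (A := Rabs x + Rabs y0 + Rabs y1).
assert (Hx := Rabs_pos x); assert (Hy0 := Rabs_pos y0); assert (Hy1 := Rabs_pos y1).
assert (Hg : forall k, 1 <= g k).
{ intros k; unfold g; pose proof (Rabs_pos (/ (2 * J k (S k)) - 1)); lra. }
assert (He : forall k, 0 <= e k).
{ intros [|k]; unfold e; [lra|].
  pose proof (Rabs_pos (1 - 2 * J (S k) (S (S k)))); pose proof (Rabs_pos (J (S k) (S k)));
  pose proof (Rabs_pos (1 - 2 * J k (S k))); lra. }
destruct (majorant_summable r A g e Hr ltac:(unfold A; lra) Hg He Hgs Hes)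
  as (d & Hd0 & Hdp & Hds & Hd).
assert (HgJ : forall k, / (2 * J k (S k)) <= g k).
{ intros k; unfold g; pose proof (Rle_abs (/ (2 * J k (S k)) - 1)); lra. }
exists d; split; [exact Hdp|]; split; [exact Hds|].
assert (Hgen : forall J' c, (forall k, 0 < J' k (S k)) ->
  (forall k, / (2 * J' k (S k)) <= g k) ->
  (forall k, Rabs (1 - 2 * J' (S k) (S (S k))) + 2 * Rabs (J' (S k) (S k))
     + Rabs (1 - 2 * J' k (S k)) <= e (S k)) ->
  solution J' x y0 y1 c -> diag_dominated r d c).
{ intros J' c H1 H2 H3 [S1 S2 S3 S4 S5].
  apply (diag_dominated_three_term J' c r A g e d); trivial;
    rewrite ?S3, ?S4, ?S5; unfold A; simpl; lra. }
split.
- intros c; apply Hgen; trivial; intros k; apply Rle_refl.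
- intros m c; apply Hgen.
  + intros k; rewrite truncation_super; destruct (lt_dec (S k) m); [apply HJ|lra].
  + intros k; rewrite truncation_super; destruct (lt_dec (S k) m); [apply HgJ|].
    replace (/ (2 * (1 / 2))) with 1 by field; apply Hg.
  + intros k; rewrite !truncation_super, truncation_diag; unfold e.
    assert (Z : Rabs (1 - 2 * (1 / 2)) = 0).
    { replace (1 - 2 * (1 / 2)) with 0 by field; apply Rabs_R0. }
    pose proof (Rabs_pos (1 - 2 * J (S k) (S (S k)))); pose proof (Rabs_pos (J (S k) (S k)));
    pose proof (Rabs_pos (1 - 2 * J k (S k))).
    destruct (lt_dec (S (S k)) m), (lt_dec (S k) m); rewrite ?Z, ?Rabs_R0; lra.
Qed.

(** * Convergence and analyticity of the symbols *)

Lemma symbol_coef_toeplitz A k :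
  symbol_coef (toeplitz_part A) k = RtoC (diag_limit A k).
Proof.
unfold symbol_coef, toeplitz_part; destruct (le_dec 0 k); [|lia].
now rewrite Nat.sub_0_r.
Qed.

Lemma geom_majoration (a : nat -> R) (r rho M : R) :
  0 <= rho < r -> (forall k, Rabs (a k) * r ^ k <= M) ->
  forall k, Rabs (a k) * rho ^ k <= M * (rho / r) ^ k.
Proof.
intros Hr Ha k.
assert (P : 0 < r ^ k) by (apply pow_lt; lra).
replace (rho ^ k) with (r ^ k * (rho / r) ^ k).
- rewrite <- Rmult_assoc; apply Rmult_le_compat_r; [|apply Ha].
  apply pow_le, Rmult_le_pos; [lra|left; apply Rinv_0_lt_compat; lra].
- rewrite <- Rpow_mult_distr; f_equal; field; lra.
Qed.

Lemma geom_ratio_bound (r rho : R) : 0 <= rho < r -> Rabs (rho / r) < 1.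
Proof.
intros H; assert (0 < / r) by (apply Rinv_0_lt_compat; lra).
rewrite Rabs_pos_eq by (apply Rmult_le_pos; lra).
apply (Rmult_lt_reg_r r); [lra|].
unfold Rdiv; rewrite Rmult_assoc, Rinv_l; lra.
Qed.

(** Treats both families at once: [F] will be [Cmat] or [Cmat_mu], known here only through the
    recurrence and the initial columns, which [J] shares with its truncations for [m >= 2]. *)
Lemma Toeplitz_symbols_converge (J K : nat -> nat -> R) (x y0 y1 : R)
  (F : (nat -> nat -> R) -> nat -> nat -> R) :
  (forall k, 0 < J k (S k)) ->
  (forall i j, J i j = free_jacobi i j + K i j) -> trace_class K ->
  solution J x y0 y1 (F J) ->
  (forall m, (2 <= m)%nat -> solution (truncation J m) x y0 y1 (F (truncation J m))) ->
  (symbol_well_defined (F J) /\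
   analytic_on unit_disc (symbol (toeplitz_part (F J)))) /\
  uniform_cv_on_compacts unit_disc
    (fun m => symbol (toeplitz_part (F (truncation J m))))
    (symbol (toeplitz_part (F J))).
Proof.
intros HJ HJK HK HF HFm.
assert (HU := fun r Hr => diag_dominated_uniform J K r x y0 y1 Hr HJ HJK HK).
assert (Hsum : forall rho, 0 <= rho < 1 ->
  ex_series (fun k => Cmod (symbol_coef (toeplitz_part (F J)) k) * rho ^ k)).
(* The midpoint [r] of [rho] and 1 leaves room on both sides: domination needs [r < 1], the
   geometric ratio [rho / r] needs [rho < r]. *)
{ intros rho Hrho; set (r := (1 + rho) / 2).
  assert (Hr : 0 < r < 1) by (unfold r; lra).
  assert (Hrr : 0 <= rho < r) by (unfold r; lra).
  destruct (HU r Hr) as (d & Hd & Hds & HdJ & _).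
  apply (@ex_series_le R_AbsRing R_CompleteNormedModule _
    (fun k => Series d * (rho / r) ^ k)).
  - intros k; rewrite symbol_coef_toeplitz, Cmod_R.
    change (Rabs (Rabs (diag_limit (F J) k) * rho ^ k) <= Series d * (rho / r) ^ k).
    rewrite Rabs_pos_eq.
    + apply (geom_majoration (diag_limit (F J))); [exact Hrr|].
      intros n; apply diag_limit_bound; auto; lra.
    + apply Rmult_le_pos; [apply Rabs_pos|apply pow_le; lra].
  - apply (ex_series_scal_l (Series d) (fun k => (rho / r) ^ k)).
    now apply ex_series_geom, geom_ratio_bound. }
split; [split; [split|]|].
- intros k; destruct (HU (1 / 2) ltac:(lra)) as (d & Hd & Hds & HdJ & _).
  exists (diag_limit (F J) k); apply (diag_limit_Series (1 / 2) d); auto; lra.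
- intros z Hz; unfold symbol.
  apply (is_pseries_CSeries _ z
    (fun k => Cmod (symbol_coef (toeplitz_part (F J)) k) * Cmod z ^ k)).
  + intros n; apply Rle_refl.
  + apply Hsum; split; [apply Cmod_ge_0|exact Hz].
- apply analytic_on_CSeries; exact Hsum.
- intros E HE HED eps Heps.
  destruct (compact_unit_disc E HE HED) as (rho & Hrho & HErho).
  set (r := (1 + rho) / 2).
  assert (Hr : 0 < r < 1) by (unfold r; lra).
  assert (Hrr : 0 <= rho < r) by (unfold r; lra).
  assert (Hq := geom_ratio_bound r rho Hrr).
  assert (Hq0 : 0 <= rho / r).
  { apply Rmult_le_pos; [lra|left; apply Rinv_0_lt_compat; lra]. }
  set (q := rho / r) in *; rewrite (Rabs_pos_eq q) in Hq by exact Hq0.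
  destruct (HU r Hr) as (d & Hd & Hds & HdJ & HdJm).
  (* The symbols will differ by at most [2 * Series (cut d m) / (1 - q)], which this choice keeps
     below [eps / 2]. *)
  destruct (Series_cut_small d (eps * (1 - q) / 4) Hds) as [N HN].
  { apply Rmult_lt_0_compat; [apply Rmult_lt_0_compat|]; lra. }
  exists (N + 2)%nat; intros m Hm z Hz.
  specialize (HN m ltac:(lia)); specialize (HErho z Hz).
  assert (Hz0 := Cmod_ge_0 z).
  set (T := fun J k => symbol_coef (toeplitz_part (F J)) k).
  assert (Hser : forall J', diag_dominated r d (F J') ->
    @is_series C_AbsRing C_NormedModule (fun k => Cmult (T J' k) (Cpow z k))
      (symbol (toeplitz_part (F J')) z)).
  { intros J' HJ'; unfold symbol.
    apply (is_series_CSeries _ (fun k => Series d * q ^ k)).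
    - intros k; rewrite Cmod_mult, Cmod_pow; unfold T.
      rewrite symbol_coef_toeplitz, Cmod_R.
      apply Rle_trans with (Rabs (diag_limit (F J') k) * rho ^ k).
      + apply Rmult_le_compat_l; [apply Rabs_pos|apply pow_incr; lra].
      + apply (geom_majoration (diag_limit (F J'))); [exact Hrr|].
        intros n; apply diag_limit_bound; auto; lra.
    - apply (ex_series_scal_l (Series d) (fun k => q ^ k)), ex_series_geom.
      now rewrite Rabs_pos_eq. }
  assert (HmD : diag_dominated r d (F (truncation J m))) by (apply (HdJm m), HFm; lia).
  assert (HD : diag_dominated r d (F J)) by now apply HdJ.
  apply Rle_lt_trans with (Series (fun k => 2 * Series (cut d m) * q ^ k)).
  + apply (is_series_Cmod_le _ _ _
      (is_series_minus (V := C_NormedModule) _ _ _ _ (Hser _ HmD) (Hser _ HD))).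
    * intros k.
      match goal with |- Cmod ?u <= _ => replace u with
        (Cmult (RtoC (diag_limit (F (truncation J m)) k - diag_limit (F J) k)) (Cpow z k)) end.
      -- rewrite Cmod_mult, Cmod_pow, Cmod_R.
         apply Rle_trans with
           (Rabs (diag_limit (F (truncation J m)) k - diag_limit (F J) k) * rho ^ k).
         ++ apply Rmult_le_compat_l; [apply Rabs_pos|apply pow_incr; lra].
         ++ apply (geom_majoration
              (fun k => diag_limit (F (truncation J m)) k - diag_limit (F J) k)); [exact Hrr|].
            intros n; apply diag_limit_close; auto; [lra|].
            apply (solution_truncation_eq J m x y0 y1); auto; try lia.
            apply HFm; lia.
      -- unfold T; rewrite !symbol_coef_toeplitz, RtoC_minus.
         unfold plus, opp; simpl; ring.
    * apply (ex_series_scal_l (2 * Series (cut d m)) (fun k => q ^ k)), ex_series_geom.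
      now rewrite Rabs_pos_eq.
  + rewrite Series_scal_l, Series_geom by now rewrite Rabs_pos_eq.
    apply (Rmult_lt_reg_r (1 - q)); [lra|].
    rewrite Rmult_assoc, Rinv_l, Rmult_1_r by lra.
    assert (0 < eps * (1 - q)) by (apply Rmult_lt_0_compat; lra).
    lra.
Qed.

Lemma truncation_pos J m : (forall k, 0 < J k (S k)) ->
  forall k, 0 < truncation J m k (S k).
Proof.
intros HJ k; rewrite truncation_super; destruct (lt_dec (S k) m); [apply HJ|lra].
Qed.

Theorem theorem5p13 (J K : nat -> nat -> R)
  (HJ : is_jacobi J)
  (HJK : forall i j : nat, J i j = free_jacobi i j + K i j)
  (HK : trace_class K) :
  (symbol_well_defined (Cmat J) /\ analytic_on unit_disc (c_symbol J)) /\
  (symbol_well_defined (Cmat_mu J) /\ analytic_on unit_disc (c_mu_symbol J)) /\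
  uniform_cv_on_compacts unit_disc
    (fun m => c_symbol (truncation J m)) (c_symbol J) /\
  uniform_cv_on_compacts unit_disc
    (fun m => c_mu_symbol (truncation J m)) (c_mu_symbol J).
Proof.
assert (Hp := jacobi_pos J HJ).
(* The initial columns involve [J 0 0] and [J 0 1], and a truncation retains the second one only
   from [m = 2] on; uniform convergence concerns large [m] alone. *)
assert (E : forall m, (2 <= m)%nat -> truncation J m 0 0 = J 0%nat 0%nat /\
   truncation J m 0 1 = J 0%nat 1%nat).
{ intros m Hm; rewrite truncation_diag, truncation_super.
  destruct (lt_dec 0 m), (lt_dec 1 m); try lia; now split. }
destruct (Toeplitz_symbols_converge J K _ _ _ Cmat Hp HJK HK (orth_solution J Hp))
  as [H1 H2].
{ intros m Hm; destruct (E m Hm) as [E0 E1]; rewrite <- E0, <- E1.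
  apply orth_solution, truncation_pos, Hp. }
destruct (Toeplitz_symbols_converge J K _ _ _ Cmat_mu Hp HJK HK (assoc_solution J Hp))
  as [H3 H4].
{ intros m Hm; destruct (E m Hm) as [_ E1]; rewrite <- E1.
  apply assoc_solution, truncation_pos, Hp. }
repeat split; trivial; try apply H1; apply H3.
Qed.
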